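(* Let $X$ be a discrete random vector with finite state space $\{x_1,\dots,x_n\}$ of $n$ distinct values, and let $Y$ and $Z$ be random variables with values in $\{0,1\}$, such that $0<p(X=x_i,Z=z)<1$ for all $i\in\{1,\dots,n\}$ and $z\in\{0,1\}$. Suppose $Y\perp Z\mid X$. Let $m\ge 2$ and suppose there are indices $1\le i_1<\dots<i_m\le n$ such that either $$p(Z=z\mid X=x_{i_1})=\dots=p(Z=z\mid X=x_{i_m})\qquad\text{for } z\in\{0,1\},$$ or $$p(Y=y\mid X=x_{i_1})=\dots=p(Y=y\mid X=x_{i_m})\qquad\text{for } y\in\{0,1\}.$$ Let $b$ be a function on $\{x_1,\dots,x_n\}$ which takes one common value on $x_{i_1},\dots,x_{i_m}$ and is otherwise injective (that is, for $i\ne j$, $b(x_i)=b(x_j)$ if and only if $i,j\in\{i_1,\dots,i_m\}$). Then $Y\perp Z\mid b(X)$, and the cardinality of the state space of $b(X)$ is smaller than that of $X$ by $m-1$, i.e. it equals $n-(m-1)$.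
   Context: The state space of a discrete random variable is the set of values it takes with positive probability; the state space of $b(X)$ is the image of $b$. For discrete random variables, $Y\perp Z\mid W$ means conditional independence: $p(Y=y,Z=z\mid W=w)=p(Y=y\mid W=w)\,p(Z=z\mid W=w)$ for all $y,z$ and all $w$ with $p(W=w)>0$. *)

(* Defs.v *)
From HB Require Import structures.
From mathcomp Require Import all_boot all_order all_algebra.
From mathcomp Require Import all_classical all_reals all_analysis.

Set Implicit Arguments.
Unset Strict Implicit.
Unset Printing Implicit Defensive.

Import Order.TTheory GRing.Theory Num.Theory.

Local Open Scope classical_set_scope.
Local Open Scope ring_scope.

(* p(A | B) as a real number, for measurable A and B with P B > 0; when P B = 0
   its value is 0. *)
Definition cprob d (T : measurableType d) (R : realType) (P : probability T R)
    (A B : set T) : R :=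
  fine (P (A `&` B)) / fine (P B).

(* In the next two definitions the variables are plain functions, so that they
   apply to b \o X for b with values in a type without sigma-algebra. If X is a
   discrete random variable (and singletons are measurable) then the events
   {b(X) = w} are measurable for every b, by measurable_dRV_preimage. *)
Definition state_space d (T : measurableType d) (R : realType)
    (P : probability T R) (E : Type) (U : T -> E) : set E :=
  [set u | (0 < P (U @^-1` [set u]))%E].

Definition cond_indep d (T : measurableType d) (R : realType)
    (P : probability T R) (E1 E2 F : Type)
    (Y : T -> E1) (Z : T -> E2) (W : T -> F) : Prop :=
  forall (y : E1) (z : E2) (w : F), (0 < P (W @^-1` [set w]))%E ->
    cprob P (Y @^-1` [set y] `&` Z @^-1` [set z]) (W @^-1` [set w]) =
    cprob P (Y @^-1` [set y]) (W @^-1` [set w]) *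
    cprob P (Z @^-1` [set z]) (W @^-1` [set w]).

Lemma measurable_tuple_set1 (R : realType) (k : nat)
    (t : k.-tuple (measurableTypeR R)) : measurable [set t].
Proof.
rewrite (_ : [set t] = \bigcap_(i in [set: 'I_k])
    ((@tnth k (measurableTypeR R))^~ i @^-1` [set tnth t i])).
  apply: fin_bigcap_measurable => // i _.
  rewrite -[X in measurable X]setTI.
  apply: measurable_tnth => //; exact: measurable_set1.
apply/seteqP; split => [u -> //|u /= h].
by apply: eq_from_tnth => i; apply: h.
Qed.

Lemma dRV_preimage_bigcup d d' (T : measurableType d)
    (T' : measurableType d') (R : realType) (P : probability T R)
    (X : {dRV P >-> T'}) (A : set T') :
  exists u : nat -> set T', [/\ forall n, u n `<=` A,
    forall n, u n = set0 \/ exists x, u n = [set x] &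
    X @^-1` A = \bigcup_n (X @^-1` u n)].
Proof.
have /countable_injP[f finj] := @countable_range _ _ _ _ X.
exists (fun n => [set x | [/\ A x, range X x & f x = n]]); split.
- by move=> n x [].
- move=> n; have [[x [Ax rx fx]]|h] :=
    pselect (exists x, [/\ A x, range X x & f x = n]).
    right; exists x; apply/seteqP; split => [y /= [_ ry fy]|y /= -> //].
    by apply: finj; rewrite ?inE// fy.
  by left; apply/seteqP; split => [x hx|//]; apply: h; exists x.
- apply/seteqP; split => [t /= At|t [n _ /= []//]].
  by exists (f (X t)) => //; split => //; exists t.
Qed.

Lemma measurable_dRV_preimage d d' (T : measurableType d)
    (T' : measurableType d') (R : realType) (P : probability T R)
    (X : {dRV P >-> T'}) (A : set T') :
  (forall x : T', measurable [set x]) -> measurable (X @^-1` A).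
Proof.
move=> m1; have [u [_ u1 ->]] := dRV_preimage_bigcup X A.
apply: bigcup_measurable => n _; rewrite -[Y in measurable Y]setTI.
by apply: measurable_funPT => //; case: (u1 n) => [->|[x ->]].
Qed.

Lemma state_space_comp d d' (T : measurableType d)
    (T' : measurableType d') (R : realType) (P : probability T R)
    (X : {dRV P >-> T'}) (F : Type) (b : T' -> F) :
  (forall x : T', measurable [set x]) ->
  state_space P (b \o X) = b @` state_space P X.
Proof.
move=> m1; apply/seteqP; split => [w /= Pw|_ [x /= Px <-]].
- apply: contrapT => nw.
  have [u [uA u1 Xu]] := dRV_preimage_bigcup X (b @^-1` [set w]).
  suff /(measure_negligible _) : P.-negligible ((b \o X) @^-1` [set w]).
    move=> /(_ (measurable_dRV_preimage X (b @^-1` [set w]) m1)) P0.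
    by move: Pw; rewrite /state_space /= P0 ltxx.
  rewrite [X in _.-negligible X]Xu; apply: negligible_bigcup => n.
  have [->|[x ux]] := u1 n; first by rewrite preimage_set0; exact: negligible_set0.
  have mx : measurable (X @^-1` [set x]) by exact: measurable_dRV_preimage.
  rewrite ux; apply/negligibleP => //; apply/eqP.
  rewrite eq_le measure_ge0 andbT leNgt; apply/negP => Px; apply: nw.
  by exists x => //; apply: (uA n); rewrite ux.
- apply: (lt_le_trans Px); apply: le_measure; rewrite ?inE.
  + exact: measurable_dRV_preimage.
  + exact: (measurable_dRV_preimage X (b @^-1` [set b x])).
  + by move=> t /= ->.
Qed.

(* Main.v *)
Require Import Defs.
From mathcomp Require Import all_boot all_order all_algebra.
From mathcomp Require Import all_classical all_reals all_analysis.
Import Order.TTheory GRing.Theory Num.Theory.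
Local Open Scope classical_set_scope.
Local Open Scope ring_scope.

(** Write p_i for p(X = x_i).  An event {b(X) = w} is, up to a null set, the
    disjoint union of the {X = x_i} with b(x_i) = w, so that p(A | b(X) = w) is
    the average of the p(A | X = x_i) over the fibre of b above w, with weights
    proportional to p_i ([cprob_comp]).  Averaging does not in general respect
    the products p(Y = y | X = x_i) p(Z = z | X = x_i), but it does when one of
    the two factors is constant on the fibre, because the constant can be
    pulled out of the average ([cond_indep_comp]).  This is the case here: a
    fibre of b with more than one element consists of collapsed states, on
    which one of the two conditional laws is constant by hypothesis.  As
    conditional independence is symmetric ([cond_indep_sym]), it does not
    matter which one.

    For the cardinality, b is injective on the states that remain when all the
    collapsed states but one are deleted, and these have the same image as the
    whole state space. *)

Section Coarsening.
Context {d d'} {T : measurableType d} {T' : measurableType d'} {R : realType}.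
Context {P : probability T R} {X : {dRV P >-> T'}}.
Hypothesis measurable_T'1 : forall t : T', measurable [set t].
Context {n : nat} {x : 'I_n -> T'}.
Hypothesis x_inj : injective x.
Hypothesis X_states : state_space P X = range x.

Let pr (A : set T) : R := fine (P A).
Let X_ i := X @^-1` [set x i].

Let measurable_X_ i : measurable (X_ i).
Proof. exact: measurable_dRV_preimage. Qed.

Let pr_X_gt0 i : 0 < pr (X_ i).
Proof.
have /= Pi : state_space P X (x i) by rewrite X_states; exists i.
by rewrite fine_gt0// Pi/= ltey_eq fin_num_measure.
Qed.

(** A value of X outside its state space has probability zero, but there may be
    infinitely many of them; that together they have probability zero is the
    formula for the state space of a function of X, applied to the indicator
    of the state space. *)
Lemma probability_notin_states : P (X @^-1` (~` range x)) = 0%E.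
Proof.
set f : T' -> bool := fun t => `[< range x t >].
apply/eqP; rewrite eq_le measure_ge0 andbT leNgt; apply/negP => Ppos.
have : state_space P (f \o X) false.
  rewrite /state_space /= (_ : _ @^-1` _ = X @^-1` (~` range x))//.
  by apply/seteqP; split => t /=; [move/asboolPn | move=> ?; apply/asboolPn].
rewrite state_space_comp// X_states => -[_ [i _ <-]].
by move=> /asboolPn; apply; exists i.
Qed.

Lemma total_probability (A : set T) : measurable A ->
  pr A = \sum_i pr (A `&` X_ i).
Proof.
move=> mA; have mXr : measurable (X @^-1` range x).
  exact: measurable_dRV_preimage.
have mAX i : measurable (A `&` X_ i) by exact: measurableI.
rewrite /pr (measureDI P mA mXr) [X in (X + _)%E](_ : _ = 0%E); last first.
  apply: (subset_measure0 (B := X @^-1` (~` range x))) => //.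
  - exact: measurableD.
  - exact: measurable_dRV_preimage.
  - exact: probability_notin_states.
rewrite add0e sum_fine; last by move=> i _; rewrite fin_num_measure.
congr fine; rewrite -(measure_bigsetU_ord _ xpredT mAX).
  congr (P _); rewrite -(bigcup_pred xpredT); apply/seteqP; split.
    by move=> t [At [i _ xi]]; exists i.
  by move=> t [i _ [At Xt]]; split => //; exists i.
move=> i j _ _ [t [[_ /= ti] [_ /= tj]]].
by apply: x_inj; rewrite -ti -tj.
Qed.

Lemma pr_cprob (A : set T) i : pr (A `&` X_ i) = cprob P A (X_ i) * pr (X_ i).
Proof. by rewrite /cprob divfK// gt_eqF// pr_X_gt0. Qed.

Context {F : Type} {b : T' -> F}.
Let W w := (b \o X) @^-1` [set w].

Lemma pr_fibre (A : set T) (w : F) : measurable A ->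
  pr (A `&` W w) = \sum_(i | `[< b (x i) = w >]) pr (A `&` X_ i).
Proof.
move=> mA; rewrite total_probability; last first.
  by apply: measurableI => //; exact: (measurable_dRV_preimage X (b @^-1` [set w])).
rewrite [RHS]big_mkcond/=; apply: eq_bigr => i _.
case: asboolP => bi.
  congr pr; apply/seteqP; split => t /=; first by move=> [[]].
  by move=> [At Xt]; do !split => //; rewrite /W /= Xt.
rewrite (_ : _ `&` _ = set0) ?/pr ?measure0//.
by apply/seteqP; split => t //= -[[_ wt] xt]; apply: bi; rewrite -xt -wt.
Qed.

Lemma cprob_comp (A : set T) (w : F) : measurable A ->
  cprob P A (W w) =
  (\sum_(i | `[< b (x i) = w >]) cprob P A (X_ i) * pr (X_ i)) /
  \sum_(i | `[< b (x i) = w >]) pr (X_ i).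
Proof.
move=> mA; rewrite {1}/cprob -/(pr _) -/(pr (W w)) pr_fibre//.
rewrite -(setTI (W w)) pr_fibre//.
by congr (_ / _); apply: eq_bigr => i _; rewrite ?setTI// pr_cprob.
Qed.

(** In the average over the fibre of w of the joint conditional probabilities,
    the factor for Z is a constant c and comes out; the same computation with
    Y left out shows that c is also the conditional probability given
    b(X) = w. *)
Lemma cond_indep_comp {E1 E2 : Type} {Y : T -> E1} {Z : T -> E2} :
  (forall y, measurable (Y @^-1` [set y])) ->
  (forall z, measurable (Z @^-1` [set z])) ->
  cond_indep P Y Z X ->
  (forall z i j, b (x i) = b (x j) ->
    cprob P (Z @^-1` [set z]) (X_ i) = cprob P (Z @^-1` [set z]) (X_ j)) ->
  cond_indep P Y Z (b \o X).
Proof.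
move=> mY mZ indep Zfibre y z w Pw.
have : state_space P (b \o X) w by [].
rewrite state_space_comp// X_states => -[_ [i0 _ <-] bi0].
have q_gt0 : 0 < \sum_(i | `[< b (x i) = w >]) pr (X_ i).
  rewrite (bigD1 i0)/=; last exact/asboolP.
  by rewrite ltr_wpDr// sumr_ge0// => i _; exact/ltW.
have Zconst i : `[< b (x i) = w >] ->
    cprob P (Z @^-1` [set z]) (X_ i) = cprob P (Z @^-1` [set z]) (X_ i0).
  by move=> /asboolP bi; apply: Zfibre; rewrite bi bi0.
rewrite -!/(W w) !cprob_comp//; last exact: measurableI.
under [X in _ = _ * (X / _)]eq_bigr => i wi do rewrite (Zconst i wi).
rewrite -mulr_sumr mulfK ?gt_eqF// mulrAC; congr (_ / _).
rewrite mulr_suml; apply: eq_bigr => i wi.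
rewrite /X_ indep; last by have : state_space P X (x i) by rewrite X_states; exists i.
by rewrite -/(X_ i) Zconst// mulrAC.
Qed.

End Coarsening.

Lemma cond_indep_sym {d} {T : measurableType d} {R : realType}
    {P : probability T R} {E1 E2 F : Type}
    {Y : T -> E1} {Z : T -> E2} {W : T -> F} :
  cond_indep P Y Z W -> cond_indep P Z Y W.
Proof. by move=> h z y w Pw; rewrite setIC mulrC; exact: h. Qed.

Lemma card_range_ord (F : Type) (k : nat) (g : 'I_k -> F) :
  injective g -> (range g #= `I_k)%card.
Proof.
move=> g_inj; have /card_eql -> : (range g #= [set: 'I_k])%card.
  by apply: inj_card_eq => i j _ _; exact: g_inj.
have <- : range (@nat_of_ord k) = `I_k.
  apply/seteqP; split => [_ [i _ <-]|i ik]; first exact: ltn_ord.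
  by exists (Ordinal ik).
by rewrite card_eq_sym; apply: inj_card_eq => i j _ _; exact: val_inj.
Qed.

Lemma card_range_collapse (F : Type) (n m : nat) (f : 'I_n -> F)
    (i_ : 'I_m -> 'I_n) :
  (0 < m)%N -> injective i_ ->
  (forall i j, i <> j -> (f i = f j <-> range i_ i /\ range i_ j)) ->
  (range f #= `I_(n - (m - 1)))%card.
Proof.
case: m i_ => // m i_ _ i_inj fE.
(* i_ ord0 represents the collapsed states, so that f maps A bijectively onto
   its range. *)
pose A : {set 'I_n} := ~: (i_ @: [set~ ord0]%SET).
have <- : #|A| = (n - (m.+1 - 1))%N.
  by rewrite cardsCs finset.setCK card_imset// cardsC1 !card_ord subn1.
have notA r : i_ r \in A -> r = ord0.
  rewrite inE; apply: contraNeq => r0.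
  by apply/imsetP; exists r; rewrite ?inE.
pose g (s : 'I_#|A|) := f (enum_val s).
have -> : range f = range g.
  apply/seteqP; split => [_ [i _ <-]|_ [s _ <-]]; last by exists (enum_val s).
  have fA j : j \in A -> range g (f j).
    by move=> jA; exists (enum_rank_in jA j) => //; rewrite /g enum_rankK_in.
  have [/fA//|] := boolP (i \in A).
  rewrite inE negbK => /imsetP[r]; rewrite !inE => /eqP r0 ->.
  have -> : f (i_ r) = f (i_ ord0).
    by apply/fE; [move/i_inj | split; [exists r | exists ord0]].
  apply: fA; rewrite inE; apply/imsetP => -[s].
  by rewrite !inE => /eqP s0 /i_inj/esym.
apply: card_range_ord => s t gst; apply: enum_val_inj.
apply: contrapT => st; have [[r _ rs] [q _ qt]] := (fE _ _ st).1 gst.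
apply: st; rewrite -rs -qt.
by rewrite (notA r) ?rs ?enum_valP// (notA q) ?qt ?enum_valP.
Qed.

Theorem theorem2 (d : measure_display) (T : measurableType d) (R : realType)
    (P : probability T R) (k n m : nat)
    (X : {dRV P >-> k.-tuple (measurableTypeR R)})
    (Y Z : {RV P >-> bool})
    (x : 'I_n -> k.-tuple (measurableTypeR R))
    (x_inj : injective x)
    (X_states : state_space P X = range x)
    (XZ_pos : forall (i : 'I_n) (z : bool),
       (0 < P (X @^-1` [set x i] `&` Z @^-1` [set z]) < 1)%E)
    (YZ_indep : cond_indep P Y Z X)
    (m_ge2 : (2 <= m)%N)
    (i_ : 'I_m -> 'I_n)
    (i_incr : {homo i_ : r s / (r < s)%N})
    (collapsible :
       (forall (z : bool) (r s : 'I_m),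
          cprob P (Z @^-1` [set z]) (X @^-1` [set x (i_ r)]) =
          cprob P (Z @^-1` [set z]) (X @^-1` [set x (i_ s)])) \/
       (forall (y : bool) (r s : 'I_m),
          cprob P (Y @^-1` [set y]) (X @^-1` [set x (i_ r)]) =
          cprob P (Y @^-1` [set y]) (X @^-1` [set x (i_ s)])))
    (F : Type) (b : k.-tuple (measurableTypeR R) -> F)
    (b_collapse : forall i j : 'I_n, i <> j ->
       (b (x i) = b (x j) <-> range i_ i /\ range i_ j)) :
  cond_indep P Y Z (b \o X) /\
  (state_space P (b \o X) #= `I_(n - (m - 1)))%card.
Proof.
have m1 := @measurable_tuple_set1 R k.
have mV (V : {RV P >-> bool}) v : measurable (V @^-1` [set v]).
  by rewrite -[X in measurable X]setTI; exact: measurable_funPT.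
have i_inj : injective i_.
  move=> r s rs; apply: ord_inj.
  by case: (ltngtP r s) => // /i_incr; rewrite rs ltnn.
have fibre_const (V : {RV P >-> bool}) :
    (forall v r s, cprob P (V @^-1` [set v]) (X @^-1` [set x (i_ r)]) =
                   cprob P (V @^-1` [set v]) (X @^-1` [set x (i_ s)])) ->
    forall v i j, b (x i) = b (x j) ->
      cprob P (V @^-1` [set v]) (X @^-1` [set x i]) =
      cprob P (V @^-1` [set v]) (X @^-1` [set x j]).
  move=> Vconst v i j bij; have [->//|/eqP ij] := eqVneq i j.
  by have [[r _ <-] [s _ <-]] := (b_collapse _ _ ij).1 bij.
split; last first.
  rewrite state_space_comp// X_states image_comp.
  by apply: (@card_range_collapse _ _ _ (b \o x) i_) => //; exact: ltnW.
case: collapsible => /fibre_const const.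
- exact: (cond_indep_comp m1 x_inj X_states).
- apply: cond_indep_sym; have ZY := cond_indep_sym YZ_indep.
  exact: (cond_indep_comp m1 x_inj X_states).
Qed.
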